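(* Let $t\in[1,2]$ and let $c_I,c_A$ be sufficiently small depending only on $\eta$. There exists a constant $c'>0$ depending only on $\eta$ such that for every test $\psi$ there exists $q\in[0,1]^N$ with $$\|q-p\|_t\ge c'\left(\sqrt{\frac{\|p_{\le I}\|_r}{n}}+\frac{\|p_{>I}\|_1^{\frac{2-t}{t}}}{n^{\frac{2t-2}{t}}}+\frac1n\right)\quad\text{and}\quad\mathbb P_p(\psi=1)+\mathbb P_q(\psi=0)\ge\eta.$$ In particular $\rho^*\gtrsim_\eta\sqrt{\|p_{\le I}\|_r/n}+\|p_{>I}\|_1^{(2-t)/t}/n^{(2t-2)/t}+1/n$.
   Context: Binomial model: $N\ge2$, $n\ge2$ even. For $q\in[0,1]^N$ one observes $X_1,\dots,X_n$ i.i.d. in $\{0,1\}^N$ with mutually independent coordinates $X_l(j)\sim\mathrm{Ber}(q_j)$; $\mathbb P_q$ is their joint law; a test is a measurable $\psi:(\{0,1\}^N)^n\to\{0,1\}$. $\|x\|_s=(\sum_j|x_j|^s)^{1/s}$. Known $p\in[0,1]^N$ with $p_1\ge\dots\ge p_N$ and $\max_jp_j\le1/2$; $\eta\in(0,1)$; $\rho^*=\inf\{\rho>0:\inf_\psi[\mathbb P_p(\psi=1)+\sup_{q\in[0,1]^N:\|p-q\|_t\ge\rho}\mathbb P_q(\psi=0)]\le\eta\}$. Notation: $r=\frac{2t}{4-t}$, $b=\frac{4-2t}{4-t}$; $x_{\le u}=(x_1,\dots,x_u,0,\dots,0)$, $x_{>u}=(0,\dots,0,x_{u+1},\dots,x_N)$.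 $I=\min\{J\in\{0,\dots,N\}:\sum_{i>J}p_i^2\le c_I/n^2\}$; $A=\max\{a\in\{1,\dots,I\}:p_a^{b/2}\ge c_A/(\sqrt n(\sum_{i\le I}p_i^r)^{1/4})\}$ with $\max\emptyset=-\infty$, $x_{\le-\infty}=0$, $x_{>-\infty}=x$; $c_I,c_A>0$ are small constants depending only on $\eta$. *)

(* Defs.v *)
From HB Require Import structures.
From mathcomp Require Import all_boot all_order all_algebra.
From mathcomp Require Import reals exp.
Set Implicit Arguments. Unset Strict Implicit. Unset Printing Implicit Defensive.
Import Order.TTheory GRing.Theory Num.Theory.
Local Open Scope ring_scope.

(* Coordinates are indexed by 'I_N = {0,...,N-1} (paper: 1..N, shifted by one). *)

Definition sample (N n : nat) := {ffun 'I_n -> {ffun 'I_N -> bool}}.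

Definition weight (R : realType) (N n : nat) (q : 'I_N -> R) (x : sample N n) : R :=
  \prod_(l < n) \prod_(j < N) (if x l j then q j else 1 - q j).

Definition Prob (R : realType) (N n : nat) (q : 'I_N -> R)
  (psi : sample N n -> bool) (b : bool) : R :=
  \sum_(x : sample N n | psi x == b) weight q x.

Definition lnorm (R : realType) (N : nat) (s : R) (x : 'I_N -> R) : R :=
  powR (\sum_(j < N) powR `|x j| s) s^-1.

Definition trunc_le (R : realType) (N : nat) (u : nat) (x : 'I_N -> R) : 'I_N -> R :=
  fun j => if (j < u)%N then x j else 0.
(* x_{>u}: keep coordinates with (1-indexed) index > u, i.e. 0-indexed j >= u. *)
Definition trunc_gt (R : realType) (N : nat) (u : nat) (x : 'I_N -> R) : 'I_N -> R :=
  fun j => if (u <= j)%N then x j else 0.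

(* sum_{i > J} p_i^2 (1-indexed) *)
Definition tail2 (R : realType) (N : nat) (p : 'I_N -> R) (J : nat) : R :=
  \sum_(j < N | (J <= j)%N) p j ^+ 2.

Definition Iidx (R : realType) (N n : nat) (cI : R) (p : 'I_N -> R) : nat :=
  find (fun J => tail2 p J <= cI / (n%:R ^+ 2)) (iota 0 N.+1).

Definition rexp (R : realType) (t : R) : R := 2 * t / (4 - t).

(* Main.v *)
Require Import Defs.
From HB Require Import structures.
From mathcomp Require Import all_boot all_order all_algebra.
From mathcomp Require Import reals exp.
From mathcomp Require Import sequences ring lra.
Import Order.TTheory GRing.Theory Num.Theory.
Local Open Scope ring_scope.

(** Each of the three terms of the rate is reached separately, by a prior under
    which the coordinates of [q] are independent and take two values [a j], [b j]
    with probabilities [w j], [1 - w j]; the mixture of the sample laws is then a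
    product over the columns of the sample. Write [x_j = n p_j].
    - [1/n]: shift one coordinate by [(1 - eta) / (2n)].
    - Tail, when [D] carries [sum_D x_j^2] small and [P = sum_D x_j >= 1]: replace
      [p_j] by [v = c / (n P)] with probability [p_j / v] and by 0 otherwise. The
      mean is unchanged, so the two laws of a column differ only through columns
      with at least two observed ones, and the columnwise total variations, at
      most [n^2 p_j v], sum to at most [c].
    - Bulk: symmetric perturbations [p_j +- g_j] with
      [g_j] proportional to [p_j^(2 / (4 - t))] are undetectable by a chi-square
      computation as long as [g_j <= p_j]. If the coordinates violating this
      constraint carry half of the bulk rate, they are so small that the tail prior
      applies to them and already yields the bulk rate. *)

(** * Elementary inequalities for finite sums and products *)

Section FiniteSums.
Context {R : realType}.

Lemma ler_sum_image {I J : finType} (h : I -> J) (F : J -> R) :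
  injective h -> (forall j, 0 <= F j) -> \sum_i F (h i) <= \sum_j F j.
Proof.
move=> h_inj F0.
rewrite -(big_imset F (h := h) (A := predT)) /=; last by move=> *; apply: h_inj.
rewrite [leRHS](bigID (mem (h @: predT))) /= lerDl.
by apply: sumr_ge0.
Qed.

Lemma ler_sum_orb {J : finType} (P Q : pred J) (F : J -> R) :
  (forall j, 0 <= F j) ->
  \sum_(j | P j || Q j) F j <= \sum_(j | P j) F j + \sum_(j | Q j) F j.
Proof.
move=> F0; rewrite big_mkcond [X in _ <= X + _]big_mkcond.
rewrite [X in _ <= _ + X]big_mkcond -big_split; apply: ler_sum => j _.
have := F0 j; case: (P j); case: (Q j) => /= Fj;
  by rewrite ?addr0 ?add0r // lerDl.
Qed.

Lemma ler_sum_sub {J : finType} (P Q : pred J) (F : J -> R) :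
  (forall j, 0 <= F j) -> (forall j, P j -> Q j) ->
  \sum_(j | P j) F j <= \sum_(j | Q j) F j.
Proof.
move=> F0 PQ; rewrite big_mkcond [leRHS]big_mkcond; apply: ler_sum => j _.
by have := PQ j; case: (P j) => [->//|_]; case: (Q j).
Qed.

Lemma sum_option {I : finType} (F : option I -> R) :
  \sum_o F o = F None + \sum_i F (Some i).
Proof.
rewrite (bigD1 None) //=; congr (_ + _).
rewrite (reindex_omap Some id) /=; last by case.
by apply: eq_bigl => i; rewrite eqxx.
Qed.

(** Weierstrass' product inequality. The induction also carries the sign of the sum and the bounds
    of the product, which control the cross terms. *)
Lemma prod_ge_1Bsum {I : finType} (d : I -> R) :
  (forall i, 0 <= d i <= 1) -> 1 - \sum_i d i <= \prod_i (1 - d i).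
Proof.
move=> d01.
suff [_ []] : 0 <= \sum_i d i /\ 0 <= \prod_i (1 - d i) <= 1
  /\ 1 - \sum_i d i <= \prod_i (1 - d i) by [].
apply: (big_ind2 (fun x y => 0 <= x /\ 0 <= y <= 1 /\ 1 - x <= y)).
- by split; [|split]; lra.
- by move=> x1 x2 y1 y2 [? [? ?]] [? [? ?]]; split; [|split]; nra.
- by move=> i _; have := d01 i; split; [|split]; lra.
Qed.

Lemma bernoulli (u : R) (k : nat) : 0 <= u <= 1 -> 1 - k%:R * u <= (1 - u) ^+ k.
Proof.
move=> u01; have := @prod_ge_1Bsum 'I_k (fun=> u) (fun=> u01).
by rewrite sumr_const prodr_const card_ord mulr_natl.
Qed.

(** Follows from [1 + x <= expR x], used at each [a i] and at minus their sum. *)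
Lemma prod_1D_le {I : finType} (a : I -> R) :
  (forall i, 0 <= a i) -> \sum_i a i < 1 ->
  \prod_i (1 + a i) <= (1 - \sum_i a i)^-1.
Proof.
move=> a0 a1; apply: (@le_trans _ _ (expR (\sum_i a i))).
  rewrite expR_sum; apply: ler_prod => i _.
  by rewrite expR_ge1Dx addr_ge0.
rewrite -[leLHS]invrK lef_pV2 ?posrE ?invr_gt0 ?expR_gt0 ?subr_gt0 //.
by rewrite -expRN expR_ge1Dx.
Qed.

(** The inductive step reduces to [k^2 s <= k + 1], which [n s <= 1] ensures for [s] of either sign.
    Averaging over [s] and [- s] in [chi2_sym_col] cancels the linear terms. *)
Lemma exp1D_le_quadratic (s : R) (n k : nat) : (k <= n)%N ->
  n%:R * s <= 1 -> -1 <= s -> (1 + s) ^+ k <= 1 + k%:R * s + (k%:R * s) ^+ 2.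
Proof.
move=> + nsB s1; elim: k => [|k IH] kn; first by rewrite expr0; lra.
have := IH (ltnW kn) => {}IH.
rewrite exprSr; apply: (le_trans (ler_wpM2r _ IH)); first lra.
rewrite -natr1.
have k0 : 0 <= k%:R :> R by [].
have kn' : k%:R <= n%:R :> R by rewrite ler_nat ltnW.
have ks1 : k%:R * s <= 1.
  case: (lerP 0 s) => s0; last by nra.
  by apply: le_trans (ler_wpM2r s0 kn') _; lra.
have : k%:R * (k%:R * s) <= k%:R + 1 :> R by nra.
move: (k%:R) k0 => z z0 h; have : z * (z * s) * s ^+ 2 <= (z + 1) * s ^+ 2.
  by rewrite ler_wpM2r ?sqr_ge0.
lra.
Qed.

End FiniteSums.

(** * The sample law as a product over columns *)

Section Columns.
Context {R : realType} {N n : nat}.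
Implicit Types (p q : 'I_N -> R) (u v : R) (c : {ffun 'I_n -> bool}).

Definition bern (u : R) (b : bool) : R := if b then u else 1 - u.

Definition bern_col (u : R) (c : {ffun 'I_n -> bool}) : R :=
  \prod_(l < n) bern u (c l).

Definition column (j : 'I_N) (x : sample N n) : {ffun 'I_n -> bool} :=
  [ffun l => x l j].

Lemma bern_ge0 u b : 0 <= u <= 1 -> 0 <= bern u b.
Proof. by case: b => /=; lra. Qed.

Lemma bern_col_ge0 u c : 0 <= u <= 1 -> 0 <= bern_col u c.
Proof. by move=> u01; apply: prodr_ge0 => l _; apply: bern_ge0. Qed.

Lemma sum_bern_col u : \sum_c bern_col u c = 1.
Proof.
rewrite /bern_col -(bigA_distr_bigA (fun (l : 'I_n) b => bern u b)).
by rewrite big1 // => l _; rewrite big_bool /=; lra.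
Qed.

Lemma weight_columns q (x : sample N n) :
  weight q x = \prod_j bern_col (q j) (column j x).
Proof.
rewrite /weight exchange_big; apply: eq_bigr => j _.
by apply: eq_bigr => l _; rewrite ffunE.
Qed.

(** Distributivity of products over sums, after transposing samples into families of columns. *)
Lemma sum_prod_columns (F : 'I_N -> {ffun 'I_n -> bool} -> R) :
  \sum_(x : sample N n) \prod_j F j (column j x) = \prod_j \sum_c F j c.
Proof.
rewrite bigA_distr_bigA.
pose tr (y : {ffun 'I_N -> {ffun 'I_n -> bool}}) : sample N n :=
  [ffun l => [ffun j => y j l]].
rewrite (reindex tr) /=.
  apply: eq_bigr => y _; apply: eq_bigr => j _; congr F.
  by apply/ffunP => l; rewrite !ffunE.
exists (fun x : sample N n => [ffun j => column j x]) => x _.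
  by apply/ffunP => j; apply/ffunP => l; rewrite !ffunE.
by apply/ffunP => j; apply/ffunP => l; rewrite !ffunE.
Qed.

Lemma Prob_ge0 q (psi : sample N n -> bool) b :
  (forall j, 0 <= q j <= 1) -> 0 <= Prob q psi b.
Proof.
move=> q01; apply: sumr_ge0 => x _; rewrite weight_columns.
by apply: prodr_ge0 => j _; apply: bern_col_ge0.
Qed.

End Columns.

(** * Le Cam's method for product two-point priors *)

Section TwoPointPrior.
Context {R : realType} {N n : nat}.
Variables (p w a b : 'I_N -> R).
Hypotheses (p01 : forall j, 0 <= p j <= 1) (w01 : forall j, 0 <= w j <= 1).
Hypotheses (a01 : forall j, 0 <= a j <= 1) (b01 : forall j, 0 <= b j <= 1).

Definition prior (e : {ffun 'I_N -> bool}) : R := \prod_j bern (w j) (e j).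

Definition draw (e : {ffun 'I_N -> bool}) (j : 'I_N) : R :=
  if e j then a j else b j.

Definition mix_col (j : 'I_N) (c : {ffun 'I_n -> bool}) : R :=
  w j * bern_col (a j) c + (1 - w j) * bern_col (b j) c.

Definition mix (x : sample N n) : R := \prod_j mix_col j (column j x).

Lemma prior_ge0 e : 0 <= prior e.
Proof. by apply: prodr_ge0 => j _; apply: bern_ge0. Qed.

Lemma sum_prior_prod (f : 'I_N -> bool -> R) :
  \sum_e prior e * \prod_j f j (e j)
    = \prod_j (w j * f j true + (1 - w j) * f j false).
Proof.
transitivity (\sum_(e : {ffun 'I_N -> bool}) \prod_j (bern (w j) (e j) * f j (e j))).
  by apply: eq_bigr => e _; rewrite big_split.
rewrite -(bigA_distr_bigA (fun j t => bern (w j) t * f j t)).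
by apply: eq_bigr => j _; rewrite big_bool.
Qed.

Lemma sum_prior : \sum_e prior e = 1.
Proof.
transitivity (\sum_e prior e * \prod_(j < N) 1).
  by apply: eq_bigr => e _; rewrite big1_eq mulr1.
by rewrite (sum_prior_prod (fun _ _ => 1)) big1 // => j _; lra.
Qed.

Lemma mix_prior x : mix x = \sum_e prior e * weight (draw e) x.
Proof.
under eq_bigr do rewrite weight_columns.
by rewrite (sum_prior_prod (fun j t =>
  bern_col (if t then a j else b j) (column j x))).
Qed.

Lemma draw01 e j : 0 <= draw e j <= 1.
Proof. by rewrite /draw; case: ifP. Qed.

Lemma mix_col_ge0 j c : 0 <= mix_col j c.
Proof.
have := w01 j; have := bern_col_ge0 (a j) c (a01 j).
have := bern_col_ge0 (b j) c (b01 j).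
by rewrite /mix_col => *; nra.
Qed.

Lemma Prob_prior psi t :
  \sum_(x : sample N n | psi x == t) mix x = \sum_e prior e * Prob (draw e) psi t.
Proof.
under eq_bigr do rewrite mix_prior.
by rewrite exchange_big; apply: eq_bigr => e _; rewrite mulr_sumr.
Qed.

(* Le Cam's two-hypothesis bound, with the mixture restricted to [good] points
   of the support at the price of the prior mass of the bad ones. *)
Lemma two_point_prior (eta d1 d2 : R) (good : pred {ffun 'I_N -> bool})
    (psi : sample N n -> bool) :
  0 <= d1 -> d1 + d2 < 1 - eta -> 0 < eta ->
  1 - d1 <= \sum_x Num.min (weight p x) (mix x) ->
  \sum_(e | ~~ good e) prior e <= d2 ->
  exists2 e, good e & eta <= Prob p psi true + Prob (draw e) psi false.
Proof.
move=> d10 d12 eta0 hmin hbad.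
have [/existsP[e /andP[ge he]]|/existsPn nogood] := boolP [exists e, good e &&
    (eta <= Prob p psi true + Prob (draw e) psi false)]; first by exists e.
exfalso.
have alpha0 : 0 <= Prob p psi true by apply: Prob_ge0.
have Hsum : 1 - d1 <= Prob p psi true + \sum_e prior e * Prob (draw e) psi false.
  apply: (le_trans hmin); rewrite -Prob_prior /Prob.
  rewrite (bigID (fun x => psi x == true)) /=.
  apply: lerD; first by apply: ler_sum => x _; rewrite ge_min lexx.
  rewrite (eq_bigl (fun x => psi x == false)); last by move=> x; case: (psi x).
  by apply: ler_sum => x _; rewrite ge_min lexx orbT.
have Hgood : \sum_(e | good e) prior e * Prob (draw e) psi false
    <= \sum_(e | good e) prior e * (eta - Prob p psi true).
  apply: ler_sum => e ge; apply: ler_wpM2l; first exact: prior_ge0.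
  by have := nogood e; rewrite ge /= -ltNge; lra.
have Hbad : \sum_(e | ~~ good e) prior e * Prob (draw e) psi false
    <= \sum_(e | ~~ good e) prior e.
  apply: ler_sum => e _; rewrite -[leRHS]mulr1; apply: ler_wpM2l; first exact: prior_ge0.
  have <- : \sum_(x : sample N n) weight (draw e) x = 1.
    under eq_bigr do rewrite weight_columns.
    rewrite (sum_prod_columns (fun j => bern_col (draw e j))) big1 // => j _.
    exact: sum_bern_col.
  rewrite [leRHS](bigID (fun x => psi x == false)) /= lerDl.
  apply: sumr_ge0 => x _; rewrite weight_columns.
  by apply: prodr_ge0 => j _; apply/bern_col_ge0/draw01.
have : \sum_(e | good e) prior e = 1 - \sum_(e | ~~ good e) prior e.
  by rewrite -sum_prior [in RHS](bigID good) /= addrK.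
move: Hsum Hgood Hbad; rewrite (bigID good) /= -mulr_suml.
set g := \sum_(e | good e) prior e; move=> H1 H2 H3 H4.
have g0 : 0 <= g by apply: sumr_ge0 => e _; apply: prior_ge0.
have b0 : 0 <= \sum_(e | ~~ good e) prior e.
  by apply: sumr_ge0 => e _; apply: prior_ge0.
have g1 : g <= 1 by lra.
(* Dropping the factor [g <= 1] from [g * (eta - Prob p psi true)] requires the other factor to be
   nonnegative; a single good point provides this. Without good points, the bad mass would be 1,
   above [d2]. *)
have [g_eq0|/existsP[e ge]] : g = 0 \/ [exists e, good e].
- case: (boolP [exists e, good e]) => [|/existsPn nog]; [by right|left].
  by rewrite /g big_pred0 // => e; apply/negbTE.
- by rewrite g_eq0 in H4; lra.
have eta_gt : 0 <= eta - Prob p psi true.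
  have := nogood e; rewrite ge /= -ltNge.
  by have := Prob_ge0 _ psi false (draw01 e); lra.
nra.
Qed.

(** The minimum of two products dominates the product of the minima, so affinities multiply over
    columns and their defects add up. *)
Lemma min_prod_columns (d : 'I_N -> R) :
  (forall j, 0 <= d j <= 1) ->
  (forall j, 1 - d j <= \sum_c Num.min (bern_col (p j) c) (mix_col j c)) ->
  1 - \sum_j d j <= \sum_x Num.min (weight p x) (mix x).
Proof.
move=> d01 hd; apply: (le_trans (prod_ge_1Bsum d d01)).
apply: (@le_trans _ _ (\prod_j \sum_c Num.min (bern_col (p j) c) (mix_col j c))).
  by apply: ler_prod => j _; rewrite hd andbT; have := d01 j; lra.
rewrite -(sum_prod_columns (fun j c => Num.min (bern_col (p j) c) (mix_col j c))).
apply: ler_sum => x _; rewrite le_min weight_columns; apply/andP; split.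
  apply: ler_prod => j _; rewrite ge_min lexx le_min mix_col_ge0.
  by rewrite bern_col_ge0 ?p01.
apply: ler_prod => j _; rewrite ge_min lexx orbT le_min mix_col_ge0.
by rewrite bern_col_ge0 ?p01.
Qed.

(* With [L] the likelihood ratio, [min 1 L >= 1 - |L - 1|] and, by AM-GM,
   [|L - 1| <= delta / 2 + (L - 1)^2 / (2 delta)]. *)
Lemma min_chi2 (delta : R) :
  0 < delta ->
  (forall x : sample N n, weight p x = 0 -> mix x = 0) ->
  1 - delta / 2 - (\prod_j \sum_c mix_col j c ^+ 2 / bern_col (p j) c - 1) / (2 * delta)
    <= \sum_(x : sample N n) Num.min (weight p x) (mix x).
Proof.
move=> delta0 abs_cont.
have mu1 : \sum_(x : sample N n) weight p x = 1.
  under eq_bigr do rewrite weight_columns.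
  rewrite (sum_prod_columns (fun j => bern_col (p j))) big1 // => j _.
  exact: sum_bern_col.
have nu1 : \sum_(x : sample N n) mix x = 1.
  rewrite /mix sum_prod_columns big1 // => j _.
  by rewrite big_split /= -!mulr_sumr !sum_bern_col; lra.
have chi2 : \sum_(x : sample N n) mix x ^+ 2 / weight p x
    = \prod_j \sum_c mix_col j c ^+ 2 / bern_col (p j) c.
  rewrite -(sum_prod_columns (fun j c => mix_col j c ^+ 2 / bern_col (p j) c)).
  apply: eq_bigr => x _; rewrite weight_columns /mix.
  by rewrite -prodrXl -prodfV -big_split.
rewrite -chi2.
(* The pointwise bound [u * (1 - delta / 2 - (L - 1)^2 / (2 * delta))] is expanded in powers of [L];
   [k1] is its constant coefficient. *)
set k1 := 1 - delta / 2 - (2 * delta)^-1.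
apply: (@le_trans _ _ (\sum_(x : sample N n) (weight p x * k1 + mix x / delta
   - mix x ^+ 2 / weight p x / (2 * delta)))).
  rewrite !big_split /= sumrN -!mulr_suml mu1 nu1 le_eqVlt; apply/orP; left.
  by apply/eqP; rewrite /k1; field; rewrite gt_eqF.
(* Where the weight vanishes, absolute continuity makes both sides 0. *)
apply: ler_sum => x _; have [mu0|mu0] := eqVneq (weight p x) 0.
  by rewrite mu0 abs_cont // expr0n /= !mul0r subr0 addr0 minxx.
have {mu0} : 0 < weight p x.
  rewrite lt_neqAle eq_sym mu0 weight_columns.
  by apply: prodr_ge0 => j _; apply: bern_col_ge0.
have : 0 <= mix x by apply: prodr_ge0 => j _; apply: mix_col_ge0.
move: (weight p x) (mix x) => u v v0 u0.
have -> : v = u * (v / u) by field; rewrite gt_eqF.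
have : 0 <= v / u by rewrite divr_ge0 // ltW.
move: (v / u) => L L0.
have -> : u * k1 + u * L / delta - (u * L) ^+ 2 / u / (2 * delta)
    = u * (1 - (delta ^+ 2 + (L - 1) ^+ 2) / (2 * delta)).
  by rewrite /k1; field; rewrite !gt_eqF.
have hd : 0 < 2 * delta by lra.
rewrite le_min -[X in _ <= X]mulr1 !ler_pM2l //.
apply/andP; split.
  by rewrite gerBl divr_ge0 ?(ltW hd) // addr_ge0 ?sqr_ge0.
rewrite lerBlDr -lerBlDl ler_pdivlMr //.
have := sqr_ge0 (delta - (1 - L)); nra.
Qed.
End TwoPointPrior.

(** * Affinity and chi-square bounds for a single column *)

Section ColumnBounds.
Context {R : realType} {n : nat}.
Implicit Types (u v g : R) (c : {ffun 'I_n -> bool}).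

(** Each entry has affinity [1 - (v - u)]; affinities multiply over the rows, and Bernoulli's
    inequality concludes. *)
Lemma min_bern_col u v : 0 <= u -> u <= v -> v <= 1 ->
  1 - n%:R * (v - u) <= \sum_c Num.min (bern_col u c) (bern_col (n := n) v c).
Proof.
move=> u0 uv v1; have : 0 <= v - u <= 1 by lra.
move=> /(bernoulli (v - u) n) /le_trans; apply.
have mem b : 0 <= Num.min (bern u b) (bern v b).
  by rewrite le_min !bern_ge0 //; lra.
have -> : (1 - (v - u)) ^+ n
    = \sum_(c : {ffun 'I_n -> bool}) \prod_(l < n) Num.min (bern u (c l)) (bern v (c l)).
  rewrite -(bigA_distr_bigA (fun (l : 'I_n) b => Num.min (bern u b) (bern v b))).
  rewrite -[in LHS](card_ord n) -prodr_const; apply: eq_bigr => l _.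
  by rewrite big_bool /= min_l // min_r; lra.
apply: ler_sum => c _; rewrite le_min; apply/andP; split;
  apply: ler_prod => l _; rewrite mem /=.
  by rewrite ge_min lexx.
by rewrite ge_min lexx orbT.
Qed.

Lemma bern_col_false u : bern_col u ([ffun=> false] : {ffun 'I_n -> bool}) = (1 - u) ^+ n.
Proof.
rewrite /bern_col -[in RHS](card_ord n) -prodr_const.
by apply: eq_bigr => l _; rewrite ffunE.
Qed.

Lemma bern_col_single u (l : 'I_n) :
  bern_col u [ffun k : 'I_n => k == l] = u * (1 - u) ^+ n.-1.
Proof.
rewrite /bern_col (bigD1 l) //= ffunE eqxx /=; congr (_ * _).
rewrite (eq_bigr (fun=> 1 - u)) => [|k /negPf kl]; last by rewrite ffunE kl.
by rewrite prodr_const cardC1 card_ord.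
Qed.

(* A column with at most one observed 1 is essentially as likely under
   Ber(u)^n as under the mixture of Ber(v)^n and the null column with mean u. *)
Lemma min_sparse_col u v : 0 <= u -> u <= v -> 0 < v -> v <= 1 ->
  1 - n%:R ^+ 2 * u * v <= \sum_c Num.min (bern_col u c)
     (u / v * bern_col v c + (1 - u / v) * bern_col (n := n) 0 c).
Proof.
move=> u0 uv v0 v1.
have w01 : 0 <= u / v <= 1 by rewrite ler_pdivrMr // mul1r uv divr_ge0 // ltW.
have wv : u / v * v = u by rewrite divfK // gt_eqF.
set w := u / v in w01 wv *.
pose F c := Num.min (bern_col u c)
  (w * bern_col v c + (1 - w) * bern_col (n := n) 0 c).
have u01 : 0 <= u <= 1 by lra.
have v01 : 0 <= v <= 1 by lra.
have z01 : 0 <= (0 : R) <= 1 by lra.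
have F0 c : 0 <= F c.
  rewrite /F le_min bern_col_ge0 //= addr_ge0 // mulr_ge0 ?bern_col_ge0 //; lra.
(* Only the null column ([None]) and the columns with a single 1 in row [l] ([Some l]) are kept.
   They contribute at least [1 - n u] and [n] times [u (1 - n v)]. *)
pose h (o : option 'I_n) : {ffun 'I_n -> bool} :=
  if o is Some l then [ffun k => k == l] else [ffun=> false].
have h_inj : injective h.
  move=> [l|] [k|] //= /ffunP E; last 1 first.
  - by have := E k; rewrite !ffunE eqxx.
  - by have := E l; rewrite !ffunE eqxx => /esym/eqP ->.
  - by have := E l; rewrite !ffunE eqxx.
apply: le_trans (ler_sum_image h F h_inj F0); rewrite sum_option /=.
have Hnil : 1 - n%:R * u <= F [ffun=> false].
  rewrite /F le_min !bern_col_false subr0 expr1n bernoulli //=.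
  by have := bernoulli v n v01; nra.
have pow1 z : 0 <= z -> z <= v -> 1 - n%:R * v <= (1 - z) ^+ n.-1.
  move=> z0 zv; have z01' : 0 <= z <= 1 by lra.
  apply: le_trans (bernoulli z n.-1 z01').
  have : n.-1%:R <= n%:R :> R by rewrite ler_nat leq_pred.
  have : 0 <= n.-1%:R :> R by [].
  by nra.
have Hone l : u * (1 - n%:R * v) <= F [ffun k => k == l].
  rewrite /F le_min !bern_col_single mul0r mulr0 addr0 mulrA wv.
  by rewrite !ler_wpM2l // pow1 // ltW.
apply: le_trans (lerD Hnil (ler_sum _ (fun l _ => Hone l))).
by rewrite sumr_const card_ord -mulr_natl; lra.
Qed.

(** The cross moment of two likelihood ratios against [u] factorises over the rows. *)
Lemma sum_bern_col_ratio u v g :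
  \sum_c bern_col (n := n) v c * bern_col g c / bern_col u c
    = (v * g / u + (1 - v) * (1 - g) / (1 - u)) ^+ n.
Proof.
rewrite -[in RHS](card_ord n) -prodr_const.
transitivity (\prod_(l in 'I_n) \sum_b bern v b * bern g b / bern u b); last first.
  by apply: eq_bigr => l _; rewrite big_bool.
rewrite (bigA_distr_bigA (fun (l : 'I_n) b => bern v b * bern g b / bern u b)).
by apply: eq_bigr => c _; rewrite /bern_col !big_split /= prodfV.
Qed.

(** Expanding the square leaves the average of [(1 + s)^n] and [(1 - s)^n], whose terms of first
    order in [s] cancel. This is why the budget is quadratic in [n g^2 / u]. *)
Lemma chi2_sym_col u g : 0 <= g -> g <= u -> u <= 1 / 2 ->
  n%:R * (g ^+ 2 / (u * (1 - u))) <= 1 ->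
  \sum_c (2^-1 * bern_col (u + g) c + (1 - 2^-1) * bern_col (n := n) (u - g) c) ^+ 2
    / bern_col u c <= 1 + (n%:R * (g ^+ 2 / (u * (1 - u)))) ^+ 2.
Proof.
move=> g0 gu u2; set s := g ^+ 2 / _ => ns1.
have u1 : 0 < 1 - u by lra.
have s0 : 0 <= s.
  by rewrite /s mulr_ge0 ?sqr_ge0 // invr_ge0 mulr_ge0; lra.
have s1 : s <= 1.
  have [uz|u0] := eqVneq u 0; first by rewrite /s uz mul0r invr0 mulr0.
  have {}u0 : 0 < u by rewrite lt_neqAle eq_sym u0 (le_trans g0).
  by rewrite /s ler_pdivrMr ?mulr_gt0 //; nra.
apply: (@le_trans _ _ (\sum_c (4^-1 * (bern_col (u + g) c * bern_col (n := n) (u + g) c / bern_col u c)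
   + 2^-1 * (bern_col (u + g) c * bern_col (u - g) c / bern_col u c)
   + 4^-1 * (bern_col (u - g) c * bern_col (u - g) c / bern_col u c)))).
  apply: ler_sum => c _; rewrite le_eqVlt; apply/orP; left; apply/eqP.
  by move: (bern_col u c)^-1 => z; field.
rewrite !big_split /= -!mulr_sumr !sum_bern_col_ratio.
have [E1 E2 E3] : [/\ (u + g) * (u + g) / u + (1 - (u + g)) * (1 - (u + g)) / (1 - u) = 1 + s,
   (u + g) * (u - g) / u + (1 - (u + g)) * (1 - (u - g)) / (1 - u) = 1 - s
   & (u - g) * (u - g) / u + (1 - (u - g)) * (1 - (u - g)) / (1 - u) = 1 + s].
  (* If [u = 0], inverting 0 gives [s = 0], and [g <= u] forces [g = 0]. *)
  have [u0|u0] := eqVneq u 0.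
    have -> : s = 0 by rewrite /s u0 mul0r invr0 mulr0.
    have -> : g = 0 by lra.
    by rewrite u0 invr0; split; field.
  by rewrite /s; split; field; rewrite u0 gt_eqF.
rewrite E1 E2 E3.
have sp : -1 <= s by lra.
have sm : -1 <= - s by lra.
have nsm : n%:R * - s <= 1.
  by have : 0 <= n%:R * s; [exact: mulr_ge0|lra].
have := exp1D_le_quadratic s n n (leqnn n) ns1 sp.
have := exp1D_le_quadratic (- s) n n (leqnn n) nsm sm.
lra.
Qed.

(** Absolute continuity, as [min_chi2] needs it: since [u <= 1 / 2], a vanishing factor can only be
    [u] itself. *)
Lemma bern_col_eq0 u v c : 0 <= u <= 1 / 2 -> (u = 0 -> v = 0) ->
  bern_col u c = 0 -> bern_col v c = 0.
Proof.
move=> u02 uv /eqP/prodf_eq0[l _ /eqP ul]; apply/eqP/prodf_eq0.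
exists l => //; move: ul; case: (c l) => /= h; last by lra.
by rewrite uv.
Qed.

End ColumnBounds.

(** * Norm comparison and the separation of order 1/n *)

Section Norm.
Context {R : realType}.

Lemma lnorm_ge (N : nat) (t v : R) (x : 'I_N -> R) : 0 < t -> 0 <= v ->
  powR v t <= \sum_j powR `|x j| t -> v <= lnorm t x.
Proof.
move=> t0 v0 h; rewrite /lnorm.
have -> : v = powR (powR v t) t^-1.
  by rewrite -powRrM mulfV ?gt_eqF // powRr1.
apply: ge0_ler_powR => //; first by rewrite invr_ge0 ltW.
- by rewrite nnegrE powR_ge0.
- by rewrite nnegrE sumr_ge0 // => j _; rewrite powR_ge0.
Qed.

(** The prior is degenerate ([w = 1], [a = b = q]). The first coordinate moves upwards, where
    [p <= 1 / 2] leaves room. *)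
Lemma base_separation (eta t : R) (N n : nat) (p : 'I_N -> R)
    (psi : sample N n -> bool) :
  0 < eta < 1 -> 0 < t -> (0 < N)%N -> (0 < n)%N ->
  (forall j, 0 <= p j <= 1 / 2) ->
  exists q : 'I_N -> R, [/\ forall j, 0 <= q j <= 1,
    (1 - eta) / 2 / n%:R <= lnorm t (fun j => q j - p j)
    & eta <= Prob p psi true + Prob q psi false].
Proof.
case: N p psi => // N p psi eta01 t0 _ n0 p02.
have n1 : 1 <= n%:R :> R by rewrite ler1n.
have n0' : 0 < n%:R :> R by lra.
set d := (1 - eta) / 2.
have dn0 : 0 <= d / n%:R by rewrite divr_ge0 // /d; lra.
have dn1 : d / n%:R <= 1 / 2 by rewrite ler_pdivrMr // /d; nra.
pose q (j : 'I_N.+1) := if j == ord0 then p j + d / n%:R else p j.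
have p01 j : 0 <= p j <= 1 by have := p02 j; lra.
have q01 j : 0 <= q j <= 1 by rewrite /q; case: ifP => _; have := p02 j; lra.
have d0 : 0 <= d by rewrite /d; lra.
have d1 : d + 0 < 1 - eta by rewrite /d; lra.
have eta0 : 0 < eta by lra.
have w01 (j : 'I_N.+1) : 0 <= (1 : R) <= 1 by lra.
have [||e _ he] := two_point_prior p (fun=> 1) q q p01 w01 q01 q01 eta d 0
  predT psi d0 d1 eta0.
- pose dj (j : 'I_N.+1) := if j == ord0 then d else 0.
  have -> : d = \sum_j dj j.
    by rewrite (bigD1 ord0) //= big1 ?addr0 // => j /negPf; rewrite /dj => ->.
  apply: min_prod_columns => // j.
    by rewrite /dj; case: ifP => _; clear w01; lra.
  under eq_bigr do rewrite /mix_col subrr mul0r addr0 mul1r.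
  have /andP[pj0 _] := p01 j; have /andP[_ qj1] := q01 j.
  apply: le_trans (min_bern_col _ _ pj0 _ qj1); last first.
    by rewrite /q; case: ifP => _; rewrite ?lerDl.
  rewrite /dj /q; case: ifP => _; last by rewrite subrr mulr0.
  by rewrite lerD2l lerN2 le_eqVlt; apply/orP; left; apply/eqP; field; rewrite gt_eqF.
- by rewrite big_pred0.
exists q; split=> //.
  apply: lnorm_ge => //; rewrite (bigD1 ord0) //= /q eqxx addrAC subrr add0r ger0_norm //.
  by rewrite lerDl sumr_ge0 // => j _; rewrite powR_ge0.
move: he; congr (_ <= _ + _); apply: eq_bigr => x _; apply: eq_bigr => l _.
by apply: eq_bigr => j _; rewrite /draw if_same.
Qed.

End Norm.

(** * The sparse prior for the tail *)

Section Sparse.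
Context {R : realType}.

Lemma expRN_le_inv (z : R) : 0 < z -> expR (- z) <= z^-1.
Proof.
move=> z0; rewrite expRN lef_pV2 ?posrE ?expR_gt0 //.
by have := expR_ge1Dx z; lra.
Qed.

(** Chernoff's lower tail: Markov's inequality for [expR] of minus the count, whose mean is at most
    [expR (- (m / 2))]; then [expR (- (m / 4)) <= 4 / m]. *)
Lemma prior_count_lower (N : nat) (w : 'I_N -> R) (S : pred 'I_N) :
  (forall j, 0 <= w j <= 1) -> let m := \sum_(j | S j) w j in 0 < m ->
  \sum_(e : {ffun 'I_N -> bool} | ~~ (m / 4 <= \sum_(j | S j) (e j)%:R)) prior w e <= 4 / m.
Proof.
move=> w01 m m0.
pose f (j : 'I_N) (t : bool) : R := expR (- (S j && t)%:R).
have fE (e : {ffun 'I_N -> bool}) : \prod_j f j (e j) = expR (- \sum_(j | S j) (e j)%:R).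
  rewrite -sumrN [in RHS]big_mkcond expR_sum; apply: eq_bigr => j _.
  by rewrite /f; case: (S j); rewrite ?oppr0.
apply: (@le_trans _ _ (\sum_(e : {ffun 'I_N -> bool}) expR (m / 4) * (prior w e * \prod_j f j (e j)))).
  rewrite [leRHS](bigID (fun e : {ffun 'I_N -> bool} =>
    ~~ (m / 4 <= \sum_(j | S j) (e j)%:R))) /=.
  apply: ler_wpDr.
    apply: sumr_ge0 => e _; rewrite fE !mulr_ge0 ?expR_ge0 //.
    exact: prior_ge0.
  apply: ler_sum => e; rewrite -ltNge fE => he.
  rewrite mulrCA -expRD -[leLHS]mulr1; apply: ler_wpM2l; first exact: prior_ge0.
  apply: le_trans (expR_ge1Dx _); rewrite lerDl; lra.
rewrite -mulr_sumr sum_prior_prod.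
apply: (@le_trans _ _ (expR (m / 4) * expR (- (m / 2)))); last first.
  rewrite -expRD; have -> : m / 4 - m / 2 = - (m / 4) by lra.
  by have -> : 4 / m = (m / 4)^-1; [field; rewrite gt_eqF|rewrite expRN_le_inv; lra].
apply: ler_wpM2l; first exact: expR_ge0.
have -> : - (m / 2) = \sum_j (if S j then - (w j / 2) else 0).
  by rewrite -big_mkcond sumrN -mulr_suml.
rewrite expR_sum; apply: ler_prod => j _; have wj := w01 j.
have e1 : expR (-1) <= 2^-1 :> R.
  rewrite expRN lef_pV2 ?posrE ?expR_gt0 //.
  by have := expR_ge1Dx (1 : R); lra.
have e0 := expR_gt0 (-1 : R).
rewrite /f andbF oppr0 expR0; case: (S j) => /=.
  by have := expR_ge1Dx (- (w j / 2)); nra.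
by rewrite oppr0 expR0; lra.
Qed.

Lemma sparse_separation (eta t c P : R) (N n : nat) (p : 'I_N -> R)
    (psi : sample N n -> bool) (D : pred 'I_N) :
  0 < eta -> 0 < c <= (1 - eta) / 20 -> P = n%:R * (\sum_(j | D j) p j) -> 1 <= t <= 2 -> (0 < n)%N ->
  (forall j, 0 <= p j <= 1 / 2) -> 1 <= P ->
  n%:R ^+ 2 * (\sum_(j | D j) p j ^+ 2) <= c / 4 ->
  exists q : 'I_N -> R, [/\ forall j, 0 <= q j <= 1,
    c / 32 * powR P ((2 - t) / t) / n%:R <= lnorm t (fun j => q j - p j)
    & eta <= Prob p psi true + Prob q psi false].
Proof.
move=> eta0 /andP[c0 c_eta] PE t12 n0 p02 P1 p2.
have n1 : 1 <= n%:R :> R by rewrite ler1n.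
have {}n0 : 0 < n%:R :> R by lra.
have c1 : c <= 1 / 20 by lra.
have P0 : 0 < P by lra.
have [v vE] : {v | v = c / (n%:R * P)} by exists (c / (n%:R * P)).
have v0 : 0 < v by rewrite vE divr_gt0 ?mulr_gt0.
have v1 : v <= 1 / 20 by rewrite vE ler_pdivrMr ?mulr_gt0 //; nra.
(* The cutoff [v / 2], rather than [v], makes every activated coordinate move by at least
   [v / 2]. *)
pose S := [pred j | D j && (p j <= v / 2)].
have PS : P / (2 * n%:R) <= \sum_(j | S j) p j.
  (* Discarded coordinates satisfy [p j <= 2 / v * p j ^+ 2], so they carry at most half of the mass
     [P / n]. *)
  have : \sum_(j | D j && ~~ (p j <= v / 2)) p j <= P / (2 * n%:R).
    apply: (@le_trans _ _ (\sum_(j | D j) 2 / v * p j ^+ 2)).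
      rewrite [leRHS](bigID (fun j => p j <= v / 2)) /=.
      apply: ler_wpDl.
        apply: sumr_ge0 => j _; rewrite mulr_ge0 ?sqr_ge0 // divr_ge0 //; lra.
      apply: ler_sum => j /andP[_]; rewrite -ltNge => vp.
      rewrite mulrAC ler_pdivlMr //; nra.
    rewrite -mulr_sumr vE invf_div.
    have -> : P / (2 * n%:R) = 2 * (n%:R * P / c) * (c / 4 / n%:R ^+ 2).
      by field; rewrite !gt_eqF.
    apply: ler_wpM2l; first by rewrite mulr_ge0 // divr_ge0 ?mulr_ge0 // ltW.
    by rewrite ler_pdivlMr ?exprn_gt0 // mulrC.
  have : \sum_(j | D j) p j = P / n%:R by rewrite PE mulrC mulKf ?gt_eqF.
  rewrite (bigID (fun j => p j <= v / 2)) /=.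
  have -> : P / n%:R = P / (2 * n%:R) + P / (2 * n%:R) by field; rewrite gt_eqF.
  rewrite /S /=; lra.
pose w j := if S j then p j / v else 0.
pose a j := if S j then v else p j.
pose b j := if S j then 0 else p j.
have pn j : D j -> n%:R * p j <= P.
  move=> Dj; rewrite PE ler_wpM2l ?(ltW n0) // (bigD1 j) //= lerDl.
  by apply: sumr_ge0 => k _; have /andP[] := p02 k.
have p01 j : 0 <= p j <= 1 by have := p02 j; lra.
have w01 j : 0 <= w j <= 1.
  rewrite /w; case: ifP => [/andP[_ pv]|_]; last by rewrite lexx ler01.
  have /andP[pj _] := p01 j.
  by rewrite divr_ge0 ?(ltW v0) //= ler_pdivrMr // mul1r; lra.
have a01 j : 0 <= a j <= 1 by rewrite /a; case: ifP => // _; lra.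
have b01 j : 0 <= b j <= 1 by rewrite /b; case: ifP => // _; rewrite lexx ler01.
pose m := \sum_(j | S j) w j.
have mE : m = (\sum_(j | S j) p j) / v.
  by rewrite mulr_suml; apply: eq_bigr => j Sj; rewrite /w Sj.
have mP : P ^+ 2 / (2 * c) <= m.
  have -> : P ^+ 2 / (2 * c) = P / (2 * n%:R) / v.
    by rewrite vE; field; rewrite !gt_eqF.
  by rewrite mE ler_pM2r ?invr_gt0.
have mc : 1 / (2 * c) <= m.
  apply: le_trans mP; rewrite ler_pM2r ?invr_gt0 ?mulr_gt0 //; nra.
have m0 : 0 < m by apply: lt_le_trans mc; rewrite divr_gt0 ?mulr_gt0.
pose d j := if S j then n%:R ^+ 2 * p j * v else 0.
have dE j : n%:R ^+ 2 * p j * v = c / P * (n%:R * p j).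
  by rewrite vE; field; rewrite !gt_eqF.
have hmin : 1 - c <= \sum_x Num.min (weight p x) (mix (n := n) w a b x).
  apply: (@le_trans _ _ (1 - \sum_j d j)).
    rewrite lerD2l lerN2 -big_mkcond /=; under eq_bigr do rewrite dE.
    rewrite -mulr_sumr -mulr_sumr mulrAC ler_pdivrMr // ler_pM2l //.
    rewrite PE ler_pM2l // [leRHS](bigID (fun j => p j <= v / 2)) /=.
    by rewrite lerDl; apply: sumr_ge0 => j _; have /andP[] := p02 j.
  apply: min_prod_columns => // j; rewrite /d.
    case: ifP => [/andP[Dj _]|_]; last by rewrite lexx ler01.
    have /andP[pj _] := p01 j.
    rewrite dE !mulr_ge0 ?invr_ge0 ?(ltW c0) ?(ltW P0) ?(ltW n0) //=.
    rewrite mulrAC ler_pdivrMr //; have := pn j Dj; nra.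
  rewrite /mix_col /w /a /b; case: ifP => [/andP[_ pv]|_].
    have /andP[pj _] := p01 j.
    by apply: min_sparse_col => //; lra.
  under eq_bigr do rewrite mul0r subr0 mul1r add0r minxx.
  by rewrite sum_bern_col subr0.
have hbad := prior_count_lower N w S w01 m0.
(* The total error is at most [9 c], within the allowance [20 c <= 1 - eta]. *)
have d12 : c + 4 / m < 1 - eta.
  suff : 4 / m <= 8 * c by lra.
  rewrite ler_pdivrMr //; move: mc; rewrite ler_pdivrMr ?mulr_gt0 //; nra.
have [e ge he] := two_point_prior p w a b p01 w01 a01 b01 eta c (4 / m)
  [pred e : {ffun 'I_N -> bool} | m / 4 <= \sum_(j | S j) (e j)%:R] psi (ltW c0) d12 eta0 hmin hbad.
exists (draw a b e); split=> //; first by move=> j; apply: draw01.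
have t0 : 0 < t by lra.
apply: lnorm_ge => //.
  by rewrite divr_ge0 ?mulr_ge0 ?powR_ge0 ?invr_ge0 //; lra.
apply: (@le_trans _ _ ((\sum_(j | S j) (e j)%:R) * powR (v / 2) t)).
  apply: (@le_trans _ _ (m / 4 * powR (v / 2) t)); last first.
    by apply: ler_wpM2r; [exact: powR_ge0|exact: ge].
  apply: (@le_trans _ _ (P ^+ 2 / (2 * c) / 4 * powR (v / 2) t)); last first.
    by rewrite ler_wpM2r ?powR_ge0 // ler_pM2r ?invr_gt0.
  (* With [v / 2 = 16 k / P], the claim becomes [k^t P^(2 - t) <= P^2 / (8 c) * (16 k / P)^t]. *)
  have [k kE] : {k | k = c / 32 / n%:R} by exists (c / 32 / n%:R).
  have k0 : 0 < k by rewrite kE !divr_gt0.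
  have -> : c / 32 * powR P ((2 - t) / t) / n%:R = k * powR P ((2 - t) / t).
    by rewrite kE [RHS]mulrAC.
  have -> : v / 2 = k * (16 / P) by rewrite vE kE; field; rewrite !gt_eqF.
  rewrite !powRM ?powR_ge0 ?divr_ge0 ?(ltW k0) ?(ltW P0) // ?invr_ge0 ?(ltW P0) //.
  rewrite -powRrM divfK ?gt_eqF // powRB ?(gt_eqF P0) ?implybT //.
  rewrite -[powR P 2]/(powR P 2%:R) powR_mulrn ?(ltW P0) //.
  rewrite -(powR_inv1 (ltW P0)) -powRrM mulN1r powRN [leRHS]mulrCA; apply: ler_wpM2l; first exact: powR_ge0.
  rewrite mulrA; apply: ler_wpM2r; first by rewrite invr_ge0 powR_ge0.
  have h16 : 1 <= powR 16 t :> R.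
    by have := @ler_powR _ (16 : R) ltac:(lra) 0 t (ltW t0); rewrite powRr0.
  rewrite -[leLHS]mulr1; apply: ler_pM => //; rewrite ?sqr_ge0 //.
  rewrite -mulrA -[leLHS]mulr1; apply: ler_wpM2l; first exact: sqr_ge0.
  rewrite -invfM -[leLHS]invr1 lef_pV2 ?posrE ?mulr_gt0 //; lra.
rewrite mulr_suml big_mkcond; apply: ler_sum => j _; case: ifP => [Sj|_]; last exact: powR_ge0.
have /andP[pj _] := p01 j; have /andP[_ pv] := Sj.
rewrite /draw; case: (e j); last by rewrite mul0r powR_ge0.
rewrite mul1r /a Sj ge0_ler_powR ?nnegrE ?normr_ge0 ?divr_ge0 ?(ltW v0) ?(ltW t0) //.
by apply: le_trans (ler_norm _); lra.
Qed.

End Sparse.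

(** * Symmetric perturbations under a chi-square budget *)

Section Dense.
Context {R : realType}.

(** Random signs give [|q j - p j| = g j] for every draw, so no point of the support is bad and
    [d2 = 0]. *)
Lemma dense_separation (eta t : R) (N n : nat) (p g : 'I_N -> R)
    (psi : sample N n -> bool) :
  0 < eta < 1 -> (forall j, 0 <= p j <= 1 / 2) -> (forall j, 0 <= g j <= p j) ->
  \sum_j (n%:R * (g j ^+ 2 / (p j * (1 - p j)))) ^+ 2 <= (1 - eta) ^+ 2 / 8 ->
  exists q : 'I_N -> R, [/\ forall j, 0 <= q j <= 1,
    lnorm t (fun j => q j - p j) = lnorm t g
    & eta <= Prob p psi true + Prob q psi false].
Proof.
move=> eta01 p02 gp.
set y := fun j => n%:R * (g j ^+ 2 / (p j * (1 - p j))).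
rewrite -[X in X <= _]/(\sum_j y j ^+ 2).
have [z zE] : {z | z = \sum_j y j ^+ 2} by exists (\sum_j y j ^+ 2).
rewrite -zE => hz.
have [h hE] : {h | h = 1 - eta} by exists (1 - eta).
rewrite -hE in hz; have h01 : 0 < h < 1 by lra.
have z8 : z <= 1 / 8 by nra.
have z0 : 0 <= z by rewrite zE; apply: sumr_ge0 => j _; apply: sqr_ge0.
have y1 j : y j <= 1.
  have : y j ^+ 2 <= z.
    by rewrite zE (bigD1 j) //= lerDl; apply: sumr_ge0 => k _; apply: sqr_ge0.
  by nra.
have p01 j : 0 <= p j <= 1 by have := p02 j; lra.
have a01 j : 0 <= p j + g j <= 1 by have := p02 j; have := gp j; lra.
have b01 j : 0 <= p j - g j <= 1 by have := p02 j; have := gp j; lra.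
have d10 : 0 <= h / 2 by lra.
have d11 : h / 2 + 0 < 1 - eta by lra.
have eta0 : 0 < eta by lra.
have w01 (j : 'I_N) : 0 <= (2^-1 : R) <= 1 by clear -h01; lra.
have hmin : 1 - h / 2 <= \sum_x Num.min (weight p x)
    (mix (n := n) (fun=> 2^-1) (fun j => p j + g j) (fun j => p j - g j) x).
  (* With [delta = h / 2], both losses in [min_chi2] are at most [h / 4]: the chi-square is at most
     [2 z <= h^2 / 4]. *)
  have h2 : 0 < h / 2 by clear w01; lra.
  apply: le_trans (min_chi2 _ _ _ _ p01 w01 a01 b01 (h / 2) h2 _); last first.
    move=> x; rewrite weight_columns => /eqP/prodf_eq0[j _ /eqP pj0].
    apply/eqP/prodf_eq0; exists j => //; apply/eqP; rewrite /mix_col.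
    have [gj0 gjp] := andP (gp j).
    rewrite (bern_col_eq0 (p j) (p j + g j)) // ?(bern_col_eq0 (p j) (p j - g j)) //.
    - by rewrite !mulr0 addr0.
    - by clear w01 => u0; lra.
    - by clear w01 => u0; lra.
  set X := \prod_j _.
  have : X <= (1 - z)^-1.
    rewrite zE; apply: (@le_trans _ _ (\prod_j (1 + y j ^+ 2))); last first.
      apply: prod_1D_le => [j|]; first exact: sqr_ge0.
      by rewrite -zE; clear w01; lra.
    apply: ler_prod => j _; have [gj0 gjp] := andP (gp j).
    have [_ pj2] := andP (p02 j).
    rewrite (chi2_sym_col _ _ gj0 gjp pj2 (y1 j)) andbT.
    apply: sumr_ge0 => c _.
    by rewrite mulr_ge0 ?sqr_ge0 // invr_ge0 bern_col_ge0.
  clear w01 => hX.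
  have : (1 - z)^-1 <= 1 + 2 * z.
    by rewrite -[leLHS]mul1r ler_pdivrMr; nra.
  move=> hz2; have : (X - 1) / (2 * (h / 2)) <= h / 4.
    by rewrite ler_pdivrMr; nra.
  by lra.
have hbad : \sum_(e : {ffun 'I_N -> bool} | ~~ predT e) prior (fun=> 2^-1 : R) e <= 0 :> R.
  by rewrite big_pred0.
have [e _ he] := two_point_prior p (fun=> 2^-1) _ _ p01 w01 a01 b01 eta (h / 2) 0
  predT psi d10 d11 eta0 hmin hbad.
exists (draw (fun j => p j + g j) (fun j => p j - g j) e); split; last exact: he.
  by move=> j; apply: draw01.
rewrite /lnorm; congr powR; apply: eq_bigr => j _; congr powR; rewrite /draw.
by case: (e j); rewrite addrAC subrr add0r ?normrN.
Qed.

End Dense.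

(** * The bulk term, by dense perturbations or by the sparse prior *)

Section Bulk.
Context {R : realType}.

Lemma powR_exprn (x a : R) (k : nat) : powR x a ^+ k = powR x (a * k%:R).
Proof. by rewrite powRrM powR_mulrn ?powR_ge0. Qed.

(** Removes the condition [1 <= P]: for [P < 1] the claimed rate is at most of order [1 / n]. *)
Lemma base_or_sparse_separation (eta t c P : R) (N n : nat) (p : 'I_N -> R)
    (psi : sample N n -> bool) (D : pred 'I_N) :
  0 < eta -> 0 < c <= (1 - eta) / 20 -> P = n%:R * (\sum_(j | D j) p j) ->
  1 <= t <= 2 -> (0 < N)%N -> (0 < n)%N -> (forall j, 0 <= p j <= 1 / 2) ->
  n%:R ^+ 2 * (\sum_(j | D j) p j ^+ 2) <= c / 4 ->
  exists q : 'I_N -> R, [/\ forall j, 0 <= q j <= 1,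
    c / 32 * powR P ((2 - t) / t) / n%:R <= lnorm t (fun j => q j - p j)
    & eta <= Prob p psi true + Prob q psi false].
Proof.
move=> eta0 c_eta PE t12 N0 n0 p02 p2.
have t0 : 0 < t by lra.
have [P1|P1] := lerP 1 P.
  exact: (sparse_separation _ _ _ _ _ _ _ _ _ eta0 c_eta PE).
have eta01 : 0 < eta < 1 by lra.
have [q [q01 hq herr]] := base_separation eta t N n p psi eta01 t0 N0 n0 p02.
exists q; split; [exact: q01| |exact: herr].
apply: (le_trans _ hq); clear q q01 hq herr; rewrite ler_pM2r ?invr_gt0 ?ltr0n //.
have P0 : 0 <= P.
  by rewrite PE mulr_ge0 // sumr_ge0 // => j _; have /andP[] := p02 j.
have b0 : 0 <= (2 - t) / t by rewrite divr_ge0; lra.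
have : powR P ((2 - t) / t) <= powR 1 ((2 - t) / t).
  by apply: ge0_ler_powR; rewrite ?nnegrE // ltW.
by rewrite powR1; nra.
Qed.

(** In the variables [n p j], the bulk rate is [S^(1 / (2 r)) / n]. The last two hypotheses express
    the minimality of [I]: the tail is small from [I] on, but not from [I.-1] on. *)
Lemma bulk_separation (eta t c cI r S : R) (N n I : nat) (p : 'I_N -> R)
    (psi : sample N n -> bool) :
  r = rexp t -> S = \sum_(j < N | (j < I)%N) powR (n%:R * p j) r ->
  0 < eta -> 0 < c <= (1 - eta) / 20 -> 0 < cI <= c / 8 ->
  1 <= t <= 2 -> (0 < N)%N -> (0 < n)%N -> (I <= N)%N ->
  (forall j, 0 <= p j <= 1 / 2) ->
  (forall i j : 'I_N, (i <= j)%N -> p j <= p i) ->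
  n%:R ^+ 2 * tail2 p I <= cI ->
  ((0 < I)%N -> cI < n%:R ^+ 2 * tail2 p I.-1) ->
  exists q : 'I_N -> R, [/\ forall j, 0 <= q j <= 1,
    c * cI / 128 * powR S (2 * r)^-1 / n%:R <= lnorm t (fun j => q j - p j)
    & eta <= Prob p psi true + Prob q psi false].
Proof.
move=> rE SE eta0 c_eta cIc t12 N0 n0' IN p02 p_anti tailI tailI1.
have [c0 c_eta'] := andP c_eta; have [cI0 cIc'] := andP cIc.
have c1 : c <= 1 / 20 by lra.
have t0 : 0 < t by lra.
have t4 : 0 < 4 - t by lra.
have n1 : 1 <= n%:R :> R by rewrite ler1n.
have n0 : 0 < n%:R :> R by lra.
have eta01 : 0 < eta < 1 by lra.
have r0 : 0 < r by rewrite rE /rexp divr_gt0 ?mulr_gt0.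
have r2 : r <= 2 by rewrite rE /rexp ler_pdivrMr //; lra.
have r1 : 2 / 3 <= r by rewrite rE /rexp ler_pdivlMr //; lra.
have p0 j : 0 <= p j by have /andP[] := p02 j.
pose x j := n%:R * p j.
have x0 j : 0 <= x j by rewrite mulr_ge0 // ltW.
have S0 : 0 <= S by rewrite SE sumr_ge0 // => j _; rewrite powR_ge0.
have [S_eq0|S_neq0] := eqVneq S 0.
  have [q [q01 hq herr]] := base_separation eta t N n p psi eta01 t0 N0 n0' p02.
  exists q; split; [exact: q01| |exact: herr].
  apply: (le_trans _ hq); clear q q01 hq herr.
  have r2n0 : (2 * r)^-1 != 0 by rewrite gt_eqF // invr_gt0 mulr_gt0.
  rewrite S_eq0 (powR0 r2n0).
  by rewrite mulr0 mul0r !divr_ge0 //; lra.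
have {}S0 : 0 < S by rewrite lt_neqAle eq_sym S_neq0.
(* Since [4 al = r + 2] and [al t = r], both [G^4 / x^2] and [G^t] are multiples of [x^r]; [lam]
   makes the former sum to [c^4] over the bulk. *)
have [al alE] : {al | al = 2 / (4 - t)} by exists (2 / (4 - t)).
have al0 : 0 < al by rewrite alE divr_gt0.
have [lam lamE] : {lam | lam = c * powR S (- 4^-1)} by exists (c * powR S (- 4^-1)).
have lam0 : 0 < lam by rewrite lamE mulr_gt0 ?powR_gt0.
have lam4 : lam ^+ 4 = c ^+ 4 / S.
  have h4 : - 4^-1 * 4%:R = -1 :> R by lra.
  by rewrite lamE exprMn powR_exprn h4 powR_inv1 // ltW.
pose G j := lam * powR (x j) al.
have G0 j : 0 <= G j by rewrite mulr_ge0 ?powR_ge0 // ltW.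
have G4 j : G j ^+ 4 = c ^+ 4 / S * powR (x j) r * x j ^+ 2.
  rewrite exprMn lam4 -mulrA; congr (_ * _).
  have [->|xn0] := eqVneq (x j) 0.
    by rewrite powR0 ?(gt_eqF al0) // !expr0n /= mulr0.
  rewrite powR_exprn -powR_mulrn ?x0 // -powRD ?xn0 ?implybT //.
  by congr powR; rewrite alE rE /rexp; field; rewrite gt_eqF.
(* [G] is the perturbation maximising [sum_j G_j^t] for a given chi-square budget
   [sum_j G_j^4 / x_j^2]; it keeps [p - G / n] nonnegative only on [B]. *)
pose B := [pred j : 'I_N | (j < I)%N && (G j <= x j)].
pose C := [pred j : 'I_N | (j < I)%N && ~~ (G j <= x j)].
have SBC : S = \sum_(j | B j) powR (x j) r + \sum_(j | C j) powR (x j) r.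
  by rewrite SE (bigID (fun j => G j <= x j)).
have [SB|SB] := lerP (S / 2) (\sum_(j | B j) powR (x j) r).
  pose g j := if B j then G j / n%:R else 0.
  have gp j : 0 <= g j <= p j.
    rewrite /g; case: ifP => [/andP[_ Gx]|_]; last by rewrite lexx p0.
    by rewrite divr_ge0 ?(ltW n0) //= ler_pdivrMr // mulrC.
  have hchi : \sum_j (n%:R * (g j ^+ 2 / (p j * (1 - p j)))) ^+ 2
      <= (1 - eta) ^+ 2 / 8.
    apply: (@le_trans _ _ (\sum_(j < N | (j < I)%N) 4 * (c ^+ 4 / S) * powR (x j) r)).
      rewrite [leRHS]big_mkcond; apply: ler_sum => j _; rewrite /g.
      have rhs0 : 0 <= 4 * (c ^+ 4 / S) * powR (x j) r.
        by rewrite mulr_ge0 ?powR_ge0 // mulr_ge0 // divr_ge0 ?exprn_ge0 // ltW.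
      case: ifP => [/andP[-> Gx]|_]; last first.
        by rewrite expr0n /= mul0r mulr0 expr0n /=; case: ifP.
      have [pj0|pjn0] := eqVneq (p j) 0.
        by rewrite pj0 mul0r invr0 !mulr0 expr0n.
      have {pjn0} pj : 0 < p j by rewrite lt_neqAle eq_sym pjn0 p0.
      have pj1 : 0 < 1 - p j by have := p02 j; lra.
      have -> : (n%:R * ((G j / n%:R) ^+ 2 / (p j * (1 - p j)))) ^+ 2
          = G j ^+ 4 / (x j ^+ 2 * (1 - p j) ^+ 2).
        by rewrite /x; field; rewrite !gt_eqF.
      have xj : 0 < x j by rewrite mulr_gt0.
      rewrite G4 ler_pdivrMr ?mulr_gt0 ?exprn_gt0 //.
      have : 1 <= 4 * (1 - p j) ^+ 2 by have := p02 j; nra.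
      move=> h4; rewrite [leRHS](_ : _ = c ^+ 4 / S * powR (x j) r * x j ^+ 2
          * (4 * (1 - p j) ^+ 2)); last by lra.
      rewrite -[leLHS]mulr1; apply: ler_wpM2l => //.
      by rewrite mulr_ge0 ?sqr_ge0 //; lra.
    rewrite -mulr_sumr -SE mulrA divfK // (_ : c ^+ 4 = c ^+ 2 * c ^+ 2); last by ring.
    have c2 : c ^+ 2 <= 1 by nra.
    have c20 : 0 <= c ^+ 2 by exact: sqr_ge0.
    by nra.
  have [q [q01 hq herr]] := dense_separation eta t N n p g psi eta01 p02 gp hchi.
  exists q; split; [exact: q01| |exact: herr]; rewrite hq; clear q q01 hq herr.
  apply: (@le_trans _ _ (lam * powR S t^-1 / 2 / n%:R)).
    rewrite ler_pM2r ?invr_gt0 // lamE.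
    have -> : c * powR S (- 4^-1) * powR S t^-1 / 2 = c / 2 * powR S (2 * r)^-1.
      suff <- : powR S (- 4^-1) * powR S t^-1 = powR S (2 * r)^-1 by lra.
      rewrite -powRD ?S_neq0 ?implybT //; congr powR.
      by rewrite rE /rexp; field; rewrite !gt_eqF.
    by apply: ler_wpM2r; [exact: powR_ge0|nra].
  apply: lnorm_ge => //; first by rewrite !mulr_ge0 ?powR_ge0 ?invr_ge0 // ltW.
  have -> : lam * powR S t^-1 / 2 / n%:R = (lam / n%:R) * (powR S t^-1 / 2).
    by field; rewrite gt_eqF.
  have ln0 : 0 < lam / n%:R by rewrite divr_gt0.
  rewrite powRM ?(ltW ln0) ?divr_ge0 ?powR_ge0 //.
  apply: (@le_trans _ _ (powR (lam / n%:R) t * \sum_(j | B j) powR (x j) r)).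
    apply: ler_wpM2l; first exact: powR_ge0.
    apply: le_trans SB.
    rewrite powRM ?powR_ge0 ?invr_ge0 // -powRrM mulVf ?(gt_eqF t0) // powRr1 ?(ltW S0) //.
    rewrite ler_pM2l //.
    have h12 : 0 < (2^-1 : R) <= 1 by lra.
    have t1 : 1 <= t by lra.
    by apply: ge1r_powR.
  rewrite mulr_sumr big_mkcond; apply: ler_sum => j _.
  have [gj0 _] := andP (gp j); rewrite ger0_norm // /g.
  case: ifP => _; last exact: powR_ge0.
  have -> : G j / n%:R = lam / n%:R * powR (x j) al by rewrite /G mulrAC.
  rewrite (powRM t (ltW ln0) (powR_ge0 _ _)) -powRrM.
  suff -> : r = al * t by [].
  by rewrite rE /rexp alE; field; rewrite gt_eqF.
(* Otherwise half of [S] sits on [C], where [x < G] forces [sum x^2 <= c^4]: these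
   coordinates can join the sparse tail, and the minimality of [I] bounds
   them from below by [cI / P], so that the sparse rate dominates the bulk one. *)
have SC : S / 2 < \sum_(j | C j) powR (x j) r by lra.
have xC j : C j -> 0 < x j /\ x j ^+ 2 <= c ^+ 4 / S * powR (x j) r.
  move=> /andP[_]; rewrite -ltNge => xG.
  have xj : 0 < x j.
    rewrite lt_neqAle x0 andbT eq_sym; apply/eqP => xj0; move: xG.
    by rewrite /G xj0 powR0 ?mulr0 ?ltxx // gt_eqF.
  split=> //; rewrite -(ler_pM2r (exprn_gt0 2 xj)) -G4 -exprD.
  by rewrite lerXn2r ?nnegrE ?G0 ?x0 // ltW.
have [j0 Cj0] : exists j, C j.
  apply/existsP; apply: contraTT SC => /existsPn noC.
  rewrite -leNgt big_pred0; first by rewrite divr_ge0 // ltW.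
  by move=> j; apply/negbTE/noC.
have I0 : (0 < I)%N by have /andP[] := Cj0; case: (I).
have i1N : (I.-1 < N)%N by rewrite prednK.
pose i1 := Ordinal i1N.
have tail1 := tailI1 I0.
(* The tail is started one coordinate early, at [I.-1], where its sum of squares still exceeds
   [cI]. *)
pose D := [pred j : 'I_N | C j || (I.-1 <= j)%N].
pose P := n%:R * \sum_(j | D j) p j.
have xx j : x j ^+ 2 = n%:R ^+ 2 * p j ^+ 2 by rewrite exprMn.
have xC2 : \sum_(j | C j) x j ^+ 2 <= c ^+ 4.
  apply: (@le_trans _ _ (\sum_(j < N | (j < I)%N) c ^+ 4 / S * powR (x j) r)).
    rewrite [leRHS](bigID (fun j => G j <= x j)) /=.
    apply: ler_wpDl.
      apply: sumr_ge0 => j _; rewrite mulr_ge0 ?powR_ge0 // divr_ge0 ?exprn_ge0 ?(ltW c0) ?(ltW S0) //.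
    by apply: ler_sum => j Cj; have [] := xC j Cj.
  by rewrite -mulr_sumr -SE divfK.
have c4 : c ^+ 4 <= c / 16.
  have -> : c ^+ 4 = (c * c) * (c * c) by ring.
  have cc1 : c * c <= 1 / 16 by nra.
  have cc2 : c * c <= c by nra.
  by nra.
(* The budget is [c / 16] for [C], [c / 16] for [i1], which lies below a coordinate of [C], and
   [c / 8] for the tail from [I] on. *)
have D2 : n%:R ^+ 2 * (\sum_(j | D j) p j ^+ 2) <= c / 4.
  rewrite mulr_sumr; under eq_bigr do rewrite -xx.
  apply: (le_trans (ler_sum_orb C (fun j : 'I_N => (I.-1 <= j)%N) (fun j => x j ^+ 2) (fun j => sqr_ge0 (x j)))).
  have xi1 : x i1 ^+ 2 <= c ^+ 4.
    apply: le_trans xC2; rewrite (bigD1 j0) //=; apply: ler_wpDr.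
      by apply: sumr_ge0 => j _; exact: sqr_ge0.
    have xji : x i1 <= x j0.
      rewrite ler_pM2l //; apply: p_anti => /=.
      by have /andP[+ _] := Cj0; case: (I) I0.
    by have := x0 i1; nra.
  have : \sum_(j < N | (I.-1 <= j)%N) x j ^+ 2 <= x i1 ^+ 2 + cI.
    rewrite (bigD1 i1) //= lerD2l; apply: le_trans tailI.
    rewrite /tail2 mulr_sumr le_eqVlt; apply/orP; left; apply/eqP.
    apply: eq_big => [j|j _]; last by rewrite xx.
    have -> : (j != i1) = (I.-1 != j) by rewrite -val_eqE eq_sym.
    by rewrite andbC -ltn_neqAle prednK.
  by lra.
have P0 : 0 <= P by rewrite mulr_ge0 ?(ltW n0) // sumr_ge0.
(* By monotonicity, the sum of squares from [I.-1] on is at most [x i1] times the sum, itself at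
   most [P]. *)
have i1P : cI <= x i1 * P.
  apply: (le_trans (ltW tail1)).
  rewrite /x /P /tail2 mulrACA -expr2 ler_pM2l ?exprn_gt0 // mulr_sumr.
  apply: (@le_trans _ _ (\sum_(j < N | (I.-1 <= j)%N) p i1 * p j)).
    apply: ler_sum => j Ij; rewrite expr2 ler_wpM2r //; exact: p_anti.
  apply: ler_sum_sub => [j|j Ij]; first by rewrite mulr_ge0.
  by rewrite /D /= Ij orbT.
have {}P0 : 0 < P.
  by rewrite lt_neqAle P0 andbT eq_sym; apply/eqP => PE; move: i1P; rewrite PE mulr0; lra.
(* For [y = x j * P >= cI], [y^r] is at most [y^2] if [y >= 1], and at most [1 <= y / cI]
   otherwise. *)
have CP j : C j -> powR (x j) r * powR P r <= x j * P / cI + x j ^+ 2 * P ^+ 2.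
  move=> Cj; have [xj _] := xC j Cj; rewrite -powRM ?x0 ?(ltW P0) // -exprMn.
  have xjP : cI <= x j * P.
    apply: (le_trans i1P); rewrite ler_pM2r // ler_pM2l //; apply: p_anti => /=.
    by have /andP[+ _] := Cj; case: (I) I0.
  have y0 : 0 < x j * P by rewrite mulr_gt0.
  move: (x j * P) y0 xjP => y y0 yc.
  have yc' : 0 <= y / cI by rewrite divr_ge0 ?ltW.
  have [y1|y1] := lerP 1 y.
    have := @ler_powR _ y y1 r 2 r2; rewrite -[powR y 2]/(powR y 2%:R) powR_mulrn; lra.
  have : powR y r <= powR 1 r by apply: ge0_ler_powR; rewrite ?nnegrE ?(ltW y0) ?(ltW y1) ?(ltW r0).
  have : 1 <= y / cI by rewrite ler_pdivlMr ?mul1r.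
  by rewrite powR1; have := sqr_ge0 y; lra.
(* As [(2 - r) / (2 r) = (2 - t) / t], this bounds the bulk rate by the sparse rate. *)
have SP : S <= 4 / cI * powR P (2 - r).
  have SCP : (\sum_(j | C j) powR (x j) r) * powR P r <= 2 / cI * P ^+ 2.
    rewrite mulr_suml; apply: (le_trans (ler_sum _ CP)).
    rewrite big_split /= -mulr_suml -mulr_suml -mulr_suml.
    have : \sum_(j | C j) x j <= P.
      rewrite -mulr_sumr ler_pM2l //.
      by apply: ler_sum_sub => // j Cj; apply/orP; left.
    have cI1 : 1 <= cI^-1 by rewrite -[leLHS]invr1 lef_pV2 ?posrE; lra.
    have P20 := sqr_ge0 P.
    move=> xCP; have : \sum_(j | C j) x j * P / cI <= P ^+ 2 / cI.
      by rewrite -?mulr_suml ler_pM2r ?invr_gt0 // expr2 ler_pM2r.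
    rewrite -!mulr_suml => h1.
    have : (\sum_(j | C j) x j ^+ 2) * P ^+ 2 <= cI^-1 * P ^+ 2.
      by apply: ler_wpM2r => //; lra.
    by lra.
  have Pr : 0 < powR P r by rewrite powR_gt0.
  rewrite powRB ?(gt_eqF P0) ?implybT // -[powR P 2]/(powR P 2%:R) powR_mulrn ?(ltW P0) //.
  by rewrite mulrA ler_pdivlMr //; nra.
have [q [q01 hq herr]] := base_or_sparse_separation eta t c P N n p psi D eta0
  c_eta erefl t12 N0 n0' p02 D2.
exists q; split; [exact: q01| |exact: herr].
apply: (le_trans _ hq); clear q q01 hq herr; rewrite ler_pM2r ?invr_gt0 //.
have -> : c * cI / 128 * powR S (2 * r)^-1 = c / 32 * (cI / 4 * powR S (2 * r)^-1) by lra.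
apply: ler_wpM2l; first by rewrite divr_ge0 // ltW.
have r20 : 0 <= (2 * r)^-1 by rewrite invr_ge0 mulr_ge0 // ltW.
have r21 : (2 * r)^-1 <= 1 by rewrite -invr1 lef_pV2 ?posrE; lra.
have cI4 : 1 <= 4 / cI by rewrite ler_pdivlMr //; lra.
apply: (@le_trans _ _ (cI / 4 * powR (4 / cI * powR P (2 - r)) (2 * r)^-1)).
  apply: ler_wpM2l; first by rewrite divr_ge0 // ltW.
  have SP0 : 0 <= 4 / cI * powR P (2 - r).
    by rewrite mulr_ge0 ?powR_ge0 // divr_ge0 // ltW.
  by apply: ge0_ler_powR; rewrite ?nnegrE ?(ltW S0).
rewrite powRM ?powR_ge0 //; last by rewrite divr_ge0 // ltW.
rewrite -powRrM (_ : (2 - r) * (2 * r)^-1 = (2 - t) / t); last first.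
  by rewrite rE /rexp; field; rewrite !gt_eqF.
rewrite mulrA -[leRHS]mul1r; apply: ler_wpM2r; first exact: powR_ge0.
have := ler1_powR cI4 r21 => h4.
by rewrite -ler_pdivlMl ?divr_gt0 // mulr1 invf_div.
Qed.

End Bulk.

(** * Rescaling of the rates by homogeneity *)

Section Rates.
Context {R : realType} {N : nat}.
Variables (n I : nat) (p : 'I_N -> R) (t : R).
Hypotheses (n_gt0 : (0 < n)%N) (p_ge0 : forall j, 0 <= p j) (t12 : 1 <= t <= 2).

Let nR_gt0 : 0 < n%:R :> R. Proof. by rewrite ltr0n. Qed.
Let t_gt0 : 0 < t. Proof. by move: t12; lra. Qed.

Lemma bulk_rate_rescale :
  Num.sqrt (lnorm (rexp t) (trunc_le I p) / n%:R)
    = powR (\sum_(j < N | (j < I)%N) powR (n%:R * p j) (rexp t)) (2 * rexp t)^-1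
      / n%:R.
Proof.
have [r rE] : {r | r = rexp t} by exists (rexp t).
rewrite -rE; have r0 : 0 < r.
  by rewrite rE /rexp divr_gt0 ?mulr_gt0 //; move: t12; lra.
have S0 : 0 <= \sum_(j < N | (j < I)%N) powR (p j) r.
  by apply: sumr_ge0 => j _; apply: powR_ge0.
have -> : \sum_(j < N | (j < I)%N) powR (n%:R * p j) r
    = powR n%:R r * \sum_(j < N | (j < I)%N) powR (p j) r.
  by rewrite mulr_sumr; apply: eq_bigr => j _; rewrite powRM.
rewrite /lnorm /trunc_le.
have -> : \sum_(j < N) powR `|if (j < I)%N then p j else 0| r
    = \sum_(j < N | (j < I)%N) powR (p j) r.
  rewrite [RHS]big_mkcond; apply: eq_bigr => j _; case: ifP => _.
    by rewrite ger0_norm.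
  by rewrite normr0 powR0 // gt_eqF.
move: (\sum_(j < N | _) _) S0 => S S0.
rewrite -[LHS]powR12_sqrt; last by rewrite divr_ge0 ?powR_ge0.
rewrite !powRM ?powR_ge0 ?invr_ge0 // -!powRrM.
have -> : r * (2 * r)^-1 = 2^-1 by field; rewrite gt_eqF.
have -> : r^-1 / 2 = (2 * r)^-1 by field; rewrite gt_eqF.
rewrite mulrAC mulrC; congr (_ * _).
rewrite -(powR_inv1 (ltW nR_gt0)) -powRrM -powRD; last by rewrite (gt_eqF nR_gt0) implybT.
by congr powR; field.
Qed.

Lemma tail_rate_rescale :
  powR (lnorm 1 (trunc_gt I p)) ((2 - t) / t) / powR n%:R ((2 * t - 2) / t)
    = powR (n%:R * \sum_(j < N | (I <= j)%N) p j) ((2 - t) / t) / n%:R.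
Proof.
have S0 : 0 <= \sum_(j < N | (I <= j)%N) p j by apply: sumr_ge0.
have -> : lnorm 1 (trunc_gt I p) = \sum_(j < N | (I <= j)%N) p j.
  rewrite /lnorm invr1 powRr1; last by apply: sumr_ge0 => j _; apply: powR_ge0.
  rewrite [RHS]big_mkcond; apply: eq_bigr => j _; rewrite /trunc_gt.
  by rewrite powRr1 ?normr_ge0 //; case: ifP => _; rewrite ?normr0 ?ger0_norm.
rewrite powRM // [in RHS]mulrAC mulrC; congr (_ * _).
rewrite -(powR_inv1 (ltW nR_gt0)) -powRN -powRD; last by rewrite (gt_eqF nR_gt0) implybT.
by congr powR; field; rewrite gt_eqF.
Qed.

End Rates.

(** The search always succeeds, because the tail from [N] on is empty; its failure at [I.-1] gives
    the last clause. *)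
Lemma IidxP {R : realType} {N n : nat} (cI : R) (p : 'I_N -> R) :
  0 < cI -> (0 < n)%N -> let I := Iidx n cI p in
  [/\ (I <= N)%N, n%:R ^+ 2 * tail2 p I <= cI &
      (0 < I)%N -> cI < n%:R ^+ 2 * tail2 p I.-1].
Proof.
move=> cI0 n0; have n2 : 0 < n%:R ^+ 2 :> R by rewrite exprn_gt0 // ltr0n.
pose a J := tail2 p J <= cI / n%:R ^+ 2.
have ha : has a (iota 0 N.+1).
  apply/hasP; exists N; first by rewrite mem_iota add0n leqnn.
  rewrite /a /tail2 big_pred0; first by rewrite divr_ge0 ?ltW.
  by move=> j; rewrite leqNgt ltn_ord.
have IN : (Iidx n cI p <= N)%N.
  by move: ha; rewrite has_find size_iota ltnS.
split=> //.
  by move: (nth_find 0 ha); rewrite nth_iota ?ltnS // /a ler_pdivlMr // mulrC.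
move=> I0; have : ((Iidx n cI p).-1 < Iidx n cI p)%N by rewrite prednK.
move=> /(before_find 0); rewrite nth_iota ?add0n; last first.
  by rewrite ltnS (leq_trans (leq_pred _)).
by move=> /negbT; rewrite -ltNge ltr_pdivrMr // mulrC.
Qed.

(** * Combination of the three separations *)

Theorem theorem2 (R : realType) (eta : R) :
  0 < eta < 1 ->
  exists c0 : R, 0 < c0 /\
  forall cI : R, 0 < cI <= c0 ->
  exists c' : R, 0 < c' /\
  forall (t : R) (N n : nat) (p : 'I_N -> R) (psi : sample N n -> bool),
    1 <= t <= 2 -> (2 <= N)%N -> (2 <= n)%N -> ~~ odd n ->
    (forall j, 0 <= p j) -> (forall j, p j <= 1 / 2) ->
    (forall i j : 'I_N, (i <= j)%N -> p j <= p i) ->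
    let I := Iidx n cI p in
    exists q : 'I_N -> R, (forall j, 0 <= q j <= 1) /\
      c' * (Num.sqrt (lnorm (rexp t) (trunc_le I p) / n%:R)
            + powR (lnorm 1 (trunc_gt I p)) ((2 - t) / t)
              / powR n%:R ((2 * t - 2) / t)
            + n%:R^-1)
        <= lnorm t (fun j => q j - p j) /\
      eta <= Prob p psi true + Prob q psi false.
Proof.
move=> eta01.
have [c cE] : {c | c = (1 - eta) / 20} by exists ((1 - eta) / 20).
have c0 : 0 < c by rewrite cE; lra.
have c1 : c <= 1 / 20 by rewrite cE; lra.
have c_eta : 0 < c <= (1 - eta) / 20 by rewrite -cE c0 lexx.
have eta0 : 0 < eta by lra.
(* The cap [c / 8] is the share of the tail in the budget [c / 4] of the sparse prior on [D]. *)
exists (c / 8); split; first by rewrite divr_gt0.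
move=> cI cIc; have [cI0 cIc'] := andP cIc.
exists (c * cI / 384); split; first by rewrite !divr_gt0 ?mulr_gt0.
move=> t N n p psi t12 N2 n2 _ p0 p2 p_anti I.
have N0 : (0 < N)%N by exact: ltnW.
have n0 : (0 < n)%N by exact: ltnW.
have p02 j : 0 <= p j <= 1 / 2 by rewrite p0 p2.
have t0 : 0 < t by lra.
have [IN tailI tailI1] := IidxP (n := n) cI p cI0 n0.
rewrite (bulk_rate_rescale n I p t n0 p0 t12) (tail_rate_rescale n I p t n0 p0 t12).
rewrite -/I in IN tailI tailI1.
set T1 := _ / n%:R; set T2 := _ / n%:R; set T3 := n%:R^-1.
have T20 : 0 <= T2 by rewrite divr_ge0 ?powR_ge0.
have T30 : 0 <= T3 by rewrite invr_ge0.
pose separated T := exists q : 'I_N -> R, [/\ forall j, 0 <= q j <= 1,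
  c * cI / 128 * T <= lnorm t (fun j => q j - p j)
  & eta <= Prob p psi true + Prob q psi false].
have H1 : separated T1.
  rewrite /separated /T1 mulrA.
  exact: (bulk_separation eta t c cI _ _ N n I p psi erefl erefl eta0 c_eta cIc
    t12 N0 n0 IN p02 p_anti tailI tailI1).
have tail_small : n%:R ^+ 2 * (\sum_(j < N | (I <= j)%N) p j ^+ 2) <= c / 4.
  by apply: (le_trans tailI); lra.
have H2 : separated T2.
  have [q2 [q201 hq2 herr2]] := base_or_sparse_separation eta t c _ N n p psi
    (fun j : 'I_N => (I <= j)%N) eta0 c_eta erefl t12 N0 n0 p02 tail_small.
  exists q2; split; [exact: q201| |exact: herr2].
  apply: (le_trans _ hq2); clear q2 q201 hq2 herr2; rewrite -[leRHS]mulrA -/T2.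
  by apply: ler_wpM2r => //; nra.
have H3 : separated T3.
  have [q3 [q301 hq3 herr3]] := base_separation eta t N n p psi eta01 t0 N0 n0 p02.
  exists q3; split; [exact: q301| |exact: herr3].
  apply: (le_trans _ hq3); clear q3 q301 hq3 herr3; rewrite -/T3.
  by apply: ler_wpM2r => //; nra.
(* The largest of the three terms is at least a third of their sum, whence [384 = 3 * 128]. *)
have combine T : T1 + T2 + T3 <= 3 * T ->
    separated T ->
    exists q : 'I_N -> R, (forall j, 0 <= q j <= 1) /\
      c * cI / 384 * (T1 + T2 + T3) <= lnorm t (fun j => q j - p j) /\
      eta <= Prob p psi true + Prob q psi false.
  move=> hT [q [q01 hq herr]]; exists q; split; first exact: q01.
  split; last exact: herr.
  apply: (le_trans _ hq); clear q q01 hq herr.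
  have -> : c * cI / 128 * T = c * cI / 384 * (3 * T) by lra.
  by apply: ler_wpM2l => //; rewrite divr_ge0 // mulr_ge0 // ltW.
have [T21|T21] := lerP T2 T1.
  have [T31|T31] := lerP T3 T1.
    by apply: (combine T1); [lra|exact: H1].
  by apply: (combine T3); [lra|exact: H3].
have [T32|T32] := lerP T3 T2.
  by apply: (combine T2); [lra|exact: H2].
by apply: (combine T3); [lra|exact: H3].
Qed.
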